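(* Let $m\in\mathbb{N}$ and $n_1,\dots,n_m\in\mathbb{N}$ be known, $n_\cdot=\sum_{i=1}^m n_i$. Let $X_{i,j}\sim\mathrm{Po}(\lambda_{i,j})$, $j=1,\dots,n_i$, $i=1,\dots,m$, $Y_i\sim\mathrm{Po}(\lambda_{i,\cdot})$, $i=1,\dots,m$, and $Z\sim\mathrm{Po}(\Lambda)$ be mutually independent, where $\lambda_{i,j}\in(0,\infty)$ are unknown, $\lambda_{i,\cdot}=\sum_{j=1}^{n_i}\lambda_{i,j}$ and $\Lambda=\sum_{i=1}^m\lambda_{i,\cdot}$. Consider estimation of $\lambda=((\lambda_{i,j})_{j})_{i}$ on the basis of $X=((X_{i,j})_j)_i$, $Y=(Y_i)_i$ and $Z$ under the entropy loss $$L^{\mathrm{KL}}(\tilde d,\lambda)=\sum_{i=1}^m\sum_{j=1}^{n_i}\Big(\tilde d_{i,j}-\lambda_{i,j}-\lambda_{i,j}\log\frac{\tilde d_{i,j}}{\lambda_{i,j}}\Big).$$ Put $X_{i,\cdot}=\sum_{j}X_{i,j}$, $X_{\cdot,\cdot}=\sum_iX_{i,\cdot}$, $Y_\cdot=\sum_iY_i$. For $\alpha>0$ and $a=(a_1,\dots,a_m)\in(0,\infty)^m$ with $a_\cdot=\sum_{i=1}^m a_i$, define estimators with $(i,j)$ components $$\hat\lambda^{(\alpha;a)}_{i,j}(X,Y,Z)=\frac{X_{\cdot,\cdot}+Y_\cdot+Z+\alpha}{3}\,\frac{X_{i,\cdot}+Y_i+a_i}{X_{\cdot,\cdot}+Y_\cdot+a_\cdot}\,\frac{X_{i,j}+1/2}{X_{i,\cdot}+n_i/2},$$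 $$\hat\lambda^{\mathrm{J}}_{i,j}(X,Y,Z)=\frac{X_{\cdot,\cdot}+Y_\cdot+Z+n_\cdot/2}{3}\,\frac{X_{i,\cdot}+Y_i+n_i/2}{X_{\cdot,\cdot}+Y_\cdot+n_\cdot/2}\,\frac{X_{i,j}+1/2}{X_{i,\cdot}+n_i/2}.$$ Assume that $n_1=\cdots=n_m>2$. Suppose that $1<\alpha<n_\cdot/2$ and $(m+1)/m\le a_1=\cdots=a_m<n_1/2$. Suppose that $$\frac23\,(n_\cdot/2-\alpha)(\alpha-1)\ge\frac32\,(m-1)(n_\cdot/2-a_\cdot)$$ and that $$\frac{(n_\cdot/2-\alpha)(n_\cdot/2-1)}{3}\ge\frac{(m-1)(n_\cdot/2-a_\cdot)}{2}.$$ Then $\hat\lambda^{\mathrm{J}}(X,Y,Z)$ is dominated by $\hat\lambda^{(\alpha;a)}(X,Y,Z)$ under the entropy loss.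
   Context: $\mathrm{Po}(\mu)$ is the Poisson distribution with mean $\mu$. The risk of an estimator $\delta$ at $\lambda$ is $E_\lambda[L^{\mathrm{KL}}(\delta(X,Y,Z),\lambda)]$. An estimator $\delta$ is dominated by $\delta'$ if the risk of $\delta'$ is at most the risk of $\delta$ for every $\lambda\in(0,\infty)^{n_1}\times\cdots\times(0,\infty)^{n_m}$, with strict inequality for at least one $\lambda$. (Here $\hat\lambda^{\mathrm{J}}$ is the generalized Bayes estimator under the Jeffreys prior.) *)

(* Defs.v *)
From HB Require Import structures.
From mathcomp Require Import all_boot all_order all_algebra.
From mathcomp Require Import all_classical all_reals all_analysis.

Set Implicit Arguments.
Unset Strict Implicit.
Unset Printing Implicit Defensive.

Import Order.TTheory GRing.Theory Num.Theory.

Local Open Scope classical_set_scope.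
Local Open Scope ring_scope.

(* Doubly indexed arrays (v_{i,j}), 1 <= i <= m, 1 <= j <= n_i. *)
Definition array (A : Type) (m : nat) (n : 'I_m -> nat) : Type :=
  forall i : 'I_m, 'I_(n i) -> A.

Definition positive_array (R : realType) (m : nat) (n : 'I_m -> nat)
    (v : array R n) : Prop :=
  forall (i : 'I_m) (j : 'I_(n i)), 0 < v i j.

(* The unused second argument of [poisson_prob] (a natural number on which the
   measure does not depend) is set to 0. *)
Definition has_poisson_law (R : realType) (d : measure_display)
    (T : measurableType d) (P : probability T R) (V : {mfun T >-> nat})
    (mu : R) : Prop :=
  forall A : set nat, distribution P V A = poisson_prob mu 0%N A.

Definition mutually_independent (R : realType) (d d' : measure_display)
    (T : measurableType d) (T' : measurableType d') (P : probability T R)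
    (I : finType) (V : I -> {mfun T >-> T'}) : Prop :=
  forall (J : {set I}) (A : I -> set T'),
    (forall k, measurable (A k)) ->
    P (\bigcap_(k in [set` J]) (V k @^-1` A k)) =
      (\prod_(k in J) P (V k @^-1` A k))%E.

(* inl (inl (i, j)) stands for X_{i,j}, inl (inr i) for Y_i, inr tt for Z. *)
Definition obs_index (m : nat) (n : 'I_m -> nat) : finType :=
  ({i : 'I_m & 'I_(n i)} + 'I_m + unit)%type.

Definition observations (d : measure_display) (T : measurableType d)
    (m : nat) (n : 'I_m -> nat) (X : array {mfun T >-> nat} n)
    (Y : 'I_m -> {mfun T >-> nat}) (Z : {mfun T >-> nat})
    (k : obs_index n) : {mfun T >-> nat} :=
  match k with
  | inl (inl ij) => X (tag ij) (tagged ij)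
  | inl (inr i) => Y i
  | inr _ => Z
  end.

Definition poisson_sampling (R : realType) (d : measure_display)
    (T : measurableType d) (m : nat) (n : 'I_m -> nat)
    (P : probability T R) (X : array {mfun T >-> nat} n)
    (Y : 'I_m -> {mfun T >-> nat}) (Z : {mfun T >-> nat})
    (lam : array R n) : Prop :=
  [/\ forall (i : 'I_m) (j : 'I_(n i)), has_poisson_law P (X i j) (lam i j),
      forall i : 'I_m, has_poisson_law P (Y i) (\sum_(j < n i) lam i j),
      has_poisson_law P Z (\sum_(i < m) \sum_(j < n i) lam i j)
    & mutually_independent P (observations X Y Z)].

Definition estimator (R : realType) (m : nat) (n : 'I_m -> nat) : Type :=
  array nat n -> ('I_m -> nat) -> nat -> array R n.

(* [ln] vanishes on nonpositive reals: this is the entropy loss only for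
   estimates with positive components. *)
Definition entropy_loss (R : realType) (m : nat) (n : 'I_m -> nat)
    (e lam : array R n) : R :=
  \sum_(i < m) \sum_(j < n i)
    (e i j - lam i j - lam i j * ln (e i j / lam i j)).

Definition risk (R : realType) (d : measure_display) (T : measurableType d)
    (m : nat) (n : 'I_m -> nat) (P : array R n -> probability T R)
    (X : array {mfun T >-> nat} n) (Y : 'I_m -> {mfun T >-> nat})
    (Z : {mfun T >-> nat}) (delta : estimator R n) (lam : array R n) : \bar R :=
  ('E_(P lam)[fun t => entropy_loss
     (delta (fun i j => X i j t) (fun i => Y i t) (Z t)) lam])%E.

Definition risk_dominated_by (R : realType) (d : measure_display)
    (T : measurableType d) (m : nat) (n : 'I_m -> nat)
    (P : array R n -> probability T R)
    (X : array {mfun T >-> nat} n) (Y : 'I_m -> {mfun T >-> nat})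
    (Z : {mfun T >-> nat}) (delta delta' : estimator R n) : Prop :=
  (forall lam : array R n, positive_array lam ->
     (risk P X Y Z delta' lam <= risk P X Y Z delta lam)%E) /\
  (exists2 lam : array R n, positive_array lam &
     (risk P X Y Z delta' lam < risk P X Y Z delta lam)%E).

Definition row_total (m : nat) (n : 'I_m -> nat) (x : array nat n)
    (i : 'I_m) : nat := (\sum_(j < n i) x i j)%N.

Definition grand_total (m : nat) (n : 'I_m -> nat) (x : array nat n) : nat :=
  (\sum_(i < m) row_total x i)%N.

Definition lambda_hat (R : realType) (m : nat) (n : 'I_m -> nat) (alpha : R)
    (a : 'I_m -> R) : estimator R n :=
  fun x y z i j =>
    ((grand_total x + \sum_(k < m) y k + z)%N%:R + alpha) / 3
    * (((row_total x i + y i)%N%:R + a i)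
       / ((grand_total x + \sum_(k < m) y k)%N%:R + \sum_(k < m) a k))
    * (((x i j)%:R + 1 / 2) / ((row_total x i)%:R + (n i)%:R / 2)).

(* Closed form of the generalized Bayes estimator under the Jeffreys prior. *)
Definition lambda_hat_Jeffreys (R : realType) (m : nat) (n : 'I_m -> nat) :
    estimator R n :=
  fun x y z i j =>
    ((grand_total x + \sum_(k < m) y k + z)%N%:R + (\sum_(k < m) n k)%N%:R / 2)
      / 3
    * (((row_total x i + y i)%N%:R + (n i)%:R / 2)
       / ((grand_total x + \sum_(k < m) y k)%N%:R + (\sum_(k < m) n k)%N%:R / 2))
    * (((x i j)%:R + 1 / 2) / ((row_total x i)%:R + (n i)%:R / 2)).

(* Main.v *)
(* Both estimators have the form (total factor) * (row factor) * (within-row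
   factor) with the same within-row factor, and the row factors sum to one, so
   the difference of the two losses involves only S = X.. + Y. + Z, the row
   totals W_i = X_i. + Y_i and their sum W, which are Poisson with means
   3 Lambda, 2 lambda_i. and 2 Lambda.  The identity mu E f(V) = E V f(V - 1),
   V ~ Po(mu), removes lambda from the difference of the risks.  The resulting
   integrand is bounded pointwise: concavity of x ln((x + b - 1)/(x + a - 1))
   replaces the W_i by W/m, and ln y <= y - 1 does the rest, leaving
     K/(W + beta - 1) - u/(S + alpha - 1),  with beta = n./2,
     u = (beta - alpha)(alpha - 1)/3,  K = (m - 1)(beta - a.)/2.
   Here K = 0 if m = 1, and beta >= 2 otherwise.  Since mu E 1/(V + c) is
   nondecreasing in mu for c >= 1, E 1/(W + beta - 1) is then at most
   (3/2) E 1/(S + beta - 1), and the first condition is (3/2) K <= u, so the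
   risk difference is at most
   - u E[1/(S + alpha - 1) - 1/(S + beta - 1)] < 0 for every lambda. *)

Require Import Defs.
From HB Require Import structures.
From mathcomp Require Import all_boot all_order all_algebra.
From mathcomp Require Import all_classical all_reals all_analysis.
From mathcomp Require Import ring lra.

Set Implicit Arguments.
Unset Strict Implicit.
Unset Printing Implicit Defensive.

Import Order.TTheory GRing.Theory Num.Theory.

Local Open Scope classical_set_scope.
Local Open Scope ring_scope.

(** * Sums of independent Poisson variables *)

(** [{ffun I -> nat}] is countable, so a preimage under [h] is a countable union of cells on which
    every [V k] is fixed. *)
Lemma measurable_comp_ffun (d d' : measure_display) (T : measurableType d)
    (U : measurableType d') (I : finType) (V : I -> {mfun T >-> nat})
    (h : {ffun I -> nat} -> U) :
  measurable_fun setT (fun t => h [ffun k => V k t]).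
Proof.
move=> _ B mB; rewrite setTI.
pose F (v : {ffun I -> nat}) : set T :=
  if h v \in B then \bigcap_(k in [set: I]) V k @^-1` [set v k] else set0.
rewrite (_ : _ @^-1` B = \bigcup_v F v).
  apply: countable_bigcupT_measurable => [|v]; first exact: countableP.
  rewrite /F; case: ifP => // _.
  apply: fin_bigcap_measurable => [|k _]; first exact: finite_finset.
  by rewrite -[X in measurable X]setTI; apply: measurable_funPT.
apply/seteqP; split => t /=.
  move=> hB; exists [ffun k => V k t] => //.
  by rewrite /F mem_set// => k _ /=; rewrite ffunE.
move=> [v _]; rewrite /F; case: ifP => // /set_mem hv Fv.
suff -> : [ffun k => V k t] = v by [].
by apply/ffunP => k; rewrite ffunE; apply: Fv.
Qed.

(* At [mu = 0] this is the point mass at 0, whereas [poisson_pmf 0] is constantly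
   1 and [poisson_prob 0] is defined as a Dirac measure. *)
Definition poisson_weight (R : realType) (mu : R) (k : nat) : R :=
  mu ^+ k * k`!%:R^-1 * expR (- mu).

(** The binomial theorem, read as the convolution formula for Poisson laws. *)
Lemma poisson_weightD (R : realType) (mu nu : R) (u : nat) :
  poisson_weight (mu + nu) u =
  \sum_(i < u.+1) poisson_weight mu (u - i) * poisson_weight nu i.
Proof.
have f0 k : k`!%:R != 0 :> R by rewrite pnatr_eq0 -lt0n fact_gt0.
rewrite /poisson_weight exprDn !mulr_suml; apply: eq_bigr => -[i /= iu] _.
rewrite opprD expRD -mulr_natr.
have -> : ('C(u, i))%:R = u`!%:R / (i`!%:R * (u - i)`!%:R) :> R.
  by rewrite -natrM -(bin_fact (n := u) (m := i))// natrM mulfK// natrM mulf_neq0.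
by field; rewrite !f0.
Qed.

(** Termwise form of Stein's identity. *)
Lemma poisson_weightS (R : realType) (mu : R) (k : nat) :
  k.+1%:R * poisson_weight mu k.+1 = mu * poisson_weight mu k.
Proof.
rewrite /poisson_weight factS natrM exprS.
have f0 : k`!%:R != 0 :> R by rewrite pnatr_eq0 -lt0n fact_gt0.
by field; rewrite f0 /= addrC natr1 pnatr_eq0.
Qed.

Lemma poisson_weight_ge0 (R : realType) (mu : R) (k : nat) :
  0 <= mu -> 0 <= poisson_weight mu k.
Proof. by move=> mu0; rewrite !mulr_ge0 ?exprn_ge0// expR_ge0. Qed.

(* Carrying the events [V_k \in A_k], [k \in J], through the induction on [s]
   makes the independence of the partial sums from the remaining variables part of
   the induction hypothesis. *)
Lemma independent_poisson_sum (R : realType) (d : measure_display)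
    (T : measurableType d) (P : probability T R) (I : finType)
    (V : I -> {mfun T >-> nat}) (mu : I -> R) :
  mutually_independent P V ->
  (forall k x, P (V k @^-1` [set x]) = (poisson_weight (mu k) x)%:E) ->
  forall (s : seq I) (J : {set I}) (A : I -> set nat) (u : nat),
  uniq s -> {in s, forall k, k \notin J} ->
  P ([set t | (\sum_(k <- s) V k t)%N = u]
     `&` \bigcap_(k in [set` J]) V k @^-1` A k)
  = ((poisson_weight (\sum_(k <- s) mu k) u)%:E *
     \prod_(k in J) P (V k @^-1` A k))%E.
Proof.
move=> indV lawV; elim=> [|l s IH] J A u.
  move=> _ _; rewrite big_nil.
  have -> : [set t | (\sum_(k <- [::]) V k t)%N = u] =
      if u == 0%N then setT else set0.
    apply/seteqP; split => t /=; rewrite big_nil.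
      by move=> <-; rewrite eqxx.
    by case: eqP => [->|].
  case: eqP => [->|u0].
    by rewrite setTI indV// /poisson_weight oppr0 expR0 fact0 invr1 !mulr1 mul1e.
  rewrite set0I measure0 /poisson_weight expr0n.
  by move/eqP: u0 => /negbTE ->; rewrite !mul0r mul0e.
move=> /= /andP[ls us] dJ.
(* Pinning [V l] to [i] puts the new variable among the events indexed by [J], where the induction
   hypothesis on [s] applies. *)
pose A' i k : set nat := if k == l then [set i] else A k.
have lJ : l \notin J by apply: dJ; rewrite mem_head.
pose G i := [set t | (\sum_(k <- s) V k t)%N = (u - i)%N]
     `&` \bigcap_(k in [set` l |: J]) V k @^-1` A' i k.
have mG i : measurable (G i).
  apply: measurableI.
    rewrite -[X in measurable X]setTI.
    have := @measurable_comp_ffun _ _ _ _ _ V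
      (fun v : {ffun I -> nat} => (\sum_(k <- s) v k)%N) measurableT
      [set (u - i)%N] Logic.I.
    rewrite (_ : (fun t => _) = (fun t => (\sum_(k <- s) V k t)%N))//.
    by apply/funext => t; apply: eq_bigr => k _; rewrite ffunE.
  apply: fin_bigcap_measurable => [|k _]; first exact: finite_finset.
  by rewrite -[X in measurable X]setTI; apply: measurable_funPT.
have -> : [set t | (\sum_(k <- l :: s) V k t)%N = u]
     `&` \bigcap_(k in [set` J]) V k @^-1` A k = \big[setU/set0]_(i < u.+1) G i.
  apply/seteqP; split => t /=.
    rewrite big_cons => -[tu tA]; rewrite -bigcup_mkord.
    exists (V l t) => /=; first by rewrite ltnS -tu leq_addr.
    split => /=; first by rewrite -tu addKn.
    move=> k /=; rewrite in_setU1 /A' /=.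
    by case: eqP => [->//|_] /= kJ; apply: tA.
  rewrite -bigcup_mkord big_cons => -[i /= iu] [/= ts tA].
  have tl : V l t = i.
    by have := tA l; rewrite /= in_setU1 /A' eqxx /=; apply.
  split; first by rewrite tl ts subnKC.
  move=> k /= kJ; have := tA k; rewrite /= in_setU1 kJ orbT => /(_ isT).
  rewrite /A'; case: eqP => // kl.
  by move: lJ; rewrite -kl kJ.
rewrite measure_bigsetU//; last first.
  move=> i j _ _ [t [[_ ti] [_ tj]]].
  have := ti l; have := tj l; rewrite /= in_setU1 /A' eqxx /=.
  by move=> /(_ isT) <- /(_ isT) <-.
transitivity ((\sum_(i < u.+1)
    (poisson_weight (\sum_(k <- s) mu k) (u - i) * poisson_weight (mu l) i)%:E
     * \prod_(k in J) P (V k @^-1` A k))%E).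
  apply: eq_bigr => i _; apply: (etrans (IH (l |: J) (A' i) (u - i)%N us _)).
    move=> k ks; rewrite in_setU1 negb_or dJ ?andbT ?inE ?ks ?orbT//.
    by apply: contraNneq ls => <-.
  rewrite [in RHS]EFinM -muleA; congr (_ * _)%E.
  rewrite big_setU1//= /A' eqxx lawV; congr (_ * _)%E.
  apply: eq_bigr => k kJ; case: eqP => // kl.
  by move: lJ; rewrite -kl kJ.
rewrite big_cons addrC poisson_weightD.
(* Finiteness of the product lets it be factored out of the sum in real arithmetic. *)
have : (\prod_(k in J) P (V k @^-1` A k) \is a fin_num)%E.
  apply: (@big_ind _ (fun x => x \is a fin_num)) => //.
    by move=> *; exact: fin_numM.
  move=> k _; apply: fin_num_measure.
  by rewrite -[X in measurable X]setTI; apply: measurable_funPT.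
move=> /fineK <-; rewrite -[RHS]EFinM mulr_suml -sumEFin.
by apply: eq_bigr => i _; rewrite EFinM.
Qed.

(** [V] is a bare function, so that sums of observations qualify directly; probabilities of
    singletons fix a law on [nat]. *)
Definition poisson_law (R : realType) (d : measure_display)
    (T : measurableType d) (P : probability T R) (V : T -> nat) (mu : R) :=
  [/\ measurable_fun setT V, 0 <= mu &
   forall x, P (V @^-1` [set x]) = (poisson_weight mu x)%:E].

(** * Stein's identity *)

Section poisson_expectation.
Context (R : realType) (d : measure_display) (T : measurableType d).
Context (P : probability T R) (V : T -> nat) (mu : R).
Hypothesis lawV : poisson_law P V mu.
Implicit Types f : nat -> R.

Let mV : measurable_fun setT V. Proof. by case: lawV. Qed.

Let measurable_compV f : measurable_fun setT (fun t => f (V t)).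
Proof. exact: measurableT_comp. Qed.

Lemma poisson_integral f : (forall k, 0 <= f k) ->
  (\int[P]_t (f (V t))%:E = \sum_(k <oo) (f k * poisson_weight mu k)%:E)%E.
Proof.
move=> f0; have [_ mu0 PV] := lawV.
have mF k : measurable (V @^-1` [set k]).
  by rewrite -[X in measurable X]setTI; apply: mV.
have -> : [set: T] = \bigcup_k V @^-1` [set k].
  by apply/seteqP; split => // t _; exists (V t).
rewrite ge0_integral_bigcup//.
- apply: eq_eseriesr => k _.
  under eq_integral => t do [rewrite inE /= => ->; over].
  by rewrite integral_cst// [in RHS]EFinM -PV.
- apply/measurable_realfun.measurable_EFinP.
  exact: measurable_funS (measurable_compV f).
- by move=> t _; rewrite lee_fin.
- by move=> i j _ _ [t [<- <-]].
Qed.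

(** The term of index 0 vanishes, which neutralises [0.-1 = 0]; an index shift then leaves
    [poisson_weightS]. *)
Lemma poisson_stein f : (forall k, 0 <= f k) ->
  (\int[P]_t ((V t)%:R * f (V t).-1)%:E = mu%:E * \int[P]_t (f (V t))%:E)%E.
Proof.
move=> f0; have [_ mu0 PV] := lawV.
rewrite (poisson_integral (f := fun k => k%:R * f k.-1)); last first.
  by move=> k; rewrite mulr_ge0.
rewrite poisson_integral// nneseries_recl//; last first.
  by move=> k _; rewrite lee_fin mulr_ge0 ?poisson_weight_ge0// mulr_ge0.
rewrite !mul0r add0e -nneseriesZl; last first.
  by move=> k _; rewrite lee_fin mulr_ge0 ?poisson_weight_ge0// mulr_ge0.
rewrite -[X in (\sum_(X <= _ <oo) _)%E]addn0 -nneseries_addn; last first.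
  by move=> k; rewrite lee_fin mulr_ge0 ?poisson_weight_ge0// mulr_ge0.
apply: eq_eseriesr => k _; rewrite addn1 /= -EFinM mulrAC poisson_weightS.
by rewrite -mulrA [_ * f k]mulrC.
Qed.

Lemma integrable_poisson_bounded f (M : R) : (forall k, 0 <= f k <= M) ->
  P.-integrable setT (EFin \o (fun t => f (V t))).
Proof.
move=> fM; apply: measurable_bounded_integrable => //.
  by apply: (le_lt_trans (probability_le1 P measurableT)); rewrite ltry.
exists M; split; first exact: num_real.
move=> x Mx t _ /=; have /andP[f0 fM'] := fM (V t).
by rewrite ger0_norm// (le_trans fM')// ltW.
Qed.

(** The unbounded factor [V t] is absorbed by Stein's identity, which equates the integral with [mu]
    times a finite one. *)
Lemma integrable_poisson_stein f (M : R) : (forall k, 0 <= f k <= M) ->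
  P.-integrable setT (EFin \o (fun t => (V t)%:R * f (V t).-1)).
Proof.
move=> fM; have f0 k : 0 <= f k by case/andP: (fM k).
apply/integrableP; split.
  apply/measurable_realfun.measurable_EFinP.
  exact: (measurable_compV (fun k => k%:R * f k.-1)).
under eq_integral => t do [rewrite /= ger0_norm ?mulr_ge0//; over].
rewrite poisson_stein//.
have [_ mu0 PV] := lawV.
have := integrable_fin_num measurableT (integrable_poisson_bounded fM).
by move=> /fineK <-; rewrite -EFinM ltry.
Qed.

Lemma Rintegral_poisson_stein f (M : R) : (forall k, 0 <= f k <= M) ->
  \int[P]_t ((V t)%:R * f (V t).-1) = mu * \int[P]_t f (V t).
Proof.
move=> fM; have f0 k : 0 <= f k by case/andP: (fM k).
rewrite /Rintegral poisson_stein// fineM//.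
exact: (integrable_fin_num measurableT (integrable_poisson_bounded fM)).
Qed.

(** The value 0 has probability [expR (- mu)], positive even for [mu = 0]. *)
Lemma Rintegral_poisson_gt0 f (M : R) : (forall k, 0 < f k <= M) ->
  0 < \int[P]_t f (V t).
Proof.
move=> fM; have f0 k : 0 <= f k by case/andP: (fM k) => /ltW.
have fM' k : 0 <= f k <= M by case/andP: (fM k) => ? ->; rewrite f0.
have [_ mu0 PV] := lawV.
rewrite fine_gt0//; apply/andP; split; last first.
  have := integrable_fin_num measurableT (integrable_poisson_bounded fM').
  by rewrite fin_numE ltey => /andP[].
rewrite poisson_integral// nneseries_recl//; last first.
  by move=> k _; rewrite lee_fin mulr_ge0 ?poisson_weight_ge0.
apply: (@lt_le_trans _ _ (f 0%N * poisson_weight mu 0)%:E).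
  rewrite lte_fin mulr_gt0//; first by case/andP: (fM 0%N).
  by rewrite /poisson_weight expr0 fact0 invr1 mulr1 mul1r expR_gt0.
rewrite leeDl//; apply: nneseries_ge0 => k _ _.
by rewrite lee_fin mulr_ge0 ?poisson_weight_ge0.
Qed.

End poisson_expectation.

(** * Logarithmic inequalities *)

Lemma ln_le_sub1 (R : realType) (x : R) : 0 < x -> ln x <= x - 1.
Proof.
by move=> x0; have := @le_ln1Dx R (x - 1); rewrite [1 + _]addrC subrK; apply; lra.
Qed.

(* The right-hand side is the tangent at [c] of the concave left-hand side. *)
Lemma mul_ln_ratio_le_tangent (R : realType) (p q x c : R) :
  0 < p -> p <= q -> 0 <= x -> 0 <= c ->
  x * ln ((x + q) / (x + p)) <=
  x * ln ((c + q) / (c + p)) + (x - c) * (c * ((c + q)^-1 - (c + p)^-1)).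
Proof.
move=> p0 pq x0 c0.
have q0 : 0 < q by lra.
have [xp xq cp cq] : [/\ 0 < x + p, 0 < x + q, 0 < c + p & 0 < c + q].
  by split; lra.
rewrite -lerBlDl -mulrBr -ln_div; [|by rewrite posrE divr_gt0..].
have := @ln_le_sub1 _ ((x + q) / (x + p) / ((c + q) / (c + p))).
rewrite !divr_gt0// => /(_ isT) /(ler_wpM2l x0) /le_trans; apply.
rewrite -subr_ge0.
(* After [ln y <= y - 1] the gap is an explicit nonnegative multiple of [(x - c) ^+ 2]. *)
rewrite [leRHS](_ : _ = (q - p) * (x - c) ^+ 2 * p
                       / ((c + q) * (c + p) * (x + p))); last first.
  by field; rewrite !gt_eqF.
apply: divr_ge0; last by rewrite ltW// !mulr_gt0.
by rewrite mulr_ge0 ?(ltW p0)// mulr_ge0 ?subr_ge0// sqr_ge0.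
Qed.

(** Jensen's inequality: the tangents at the mean [c] of the [w i] have linear terms that sum to
    zero. *)
Lemma sum_mul_ln_ratio_le (R : realType) (m : nat) (p q : R) (w : 'I_m -> R) :
  0 < p -> p <= q -> (forall i, 0 <= w i) ->
  \sum_(i < m) w i * ln ((w i + q) / (w i + p)) <=
  (\sum_(i < m) w i) * ln ((\sum_(i < m) w i + m%:R * q)
                           / (\sum_(i < m) w i + m%:R * p)).
Proof.
move=> p0 pq w0; case: m => [|m] in w w0 *.
  by rewrite !big_ord0 mul0r.
set W := \sum_(i < _) w i.
have m0 : m.+1%:R != 0 :> R by rewrite pnatr_eq0.
have W0 : 0 <= W by apply: sumr_ge0.
pose c := W / m.+1%:R.
have c0 : 0 <= c by rewrite divr_ge0.
have -> : (W + m.+1%:R * q) / (W + m.+1%:R * p) = (c + q) / (c + p).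
  have cp : 0 < c + p by lra.
  have -> : W = m.+1%:R * c by rewrite /c mulrC divfK.
  by rewrite -!mulrDr -mulf_div divff// mul1r.
apply: le_trans (ler_sum _ (fun i _ =>
  mul_ln_ratio_le_tangent p0 pq (w0 i) c0)) _.
rewrite big_split/= -!mulr_suml -/W sumrB sumr_const card_ord -/W.
by rewrite -[c *+ _]mulr_natr /c divfK// subrr mul0r addr0.
Qed.

(** With [A] and [B] equal to [m] times the row parameters, Jensen yields the shift [- m] where
    Stein's identity for the total yields [- 1]. The right-hand side is the price of this mismatch;
    it vanishes for [m = 1]. *)
Lemma mul_ln_ratio_shift_le (R : realType) (m W A B : R) :
  1 <= m -> m < A -> A <= B -> 0 <= W ->
  W * ln ((W + (B - m)) / (W + (A - m)))
    - W * ln ((W + (B - 1)) / (W + (A - 1)))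
  <= (m - 1) * (B - A) / (W + B - 1).
Proof.
move=> m1 mA AB W0.
have [h1 h2 h3 h4] : [/\ 0 < W + (B - m), 0 < W + (A - m),
  0 < W + (B - 1) & 0 < W + (A - 1)] by split; lra.
rewrite -mulrBr -ln_div; [|by rewrite posrE divr_gt0..].
have := @ln_le_sub1 _ ((W + (B - m)) / (W + (A - m)) /
  ((W + (B - 1)) / (W + (A - 1)))).
rewrite !divr_gt0// => /(_ isT) /(ler_wpM2l W0) /le_trans; apply.
rewrite -subr_ge0 [leRHS](_ : _ = (m - 1) * (B - A) * (A - m)
   / ((W + (B - 1)) * (W + (A - m)))); last first.
  have -> : W + B - 1 = W + (B - 1) by rewrite addrA.
  by field; rewrite !gt_eqF.
apply: divr_ge0; last by rewrite ltW// mulr_gt0.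
by rewrite !mulr_ge0 ?subr_ge0// ltW.
Qed.

(** At [k = 0], where [k.-1] is not [k - 1], the factor [k] kills both sides. *)
Lemma mul_ln_ratio_pred (R : realType) (p q : R) (k : nat) :
  k%:R * ln ((k.-1%:R + q) / (k.-1%:R + p)) =
  k%:R * ln ((k%:R + (q - 1)) / (k%:R + (p - 1))).
Proof.
case: k => [|k]; first by rewrite !mul0r.
rewrite /= -natr1.
by have E (x : R) : k%:R + 1 + (x - 1) = k%:R + x; [ring | rewrite !E].
Qed.

(** Jensen for the rows, the shift estimate for [W] and [ln y <= y - 1] for [s] bound the
    logarithmic parts separately. *)
Lemma stein_integrand_le (R : realType) (m s W : nat) (w : 'I_m -> nat)
    (alpha b a : R) :
  W = (\sum_(i < m) w i)%N ->
  (0 < m)%N -> 1 < alpha -> alpha <= m%:R * b ->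
  1 < a -> a <= b ->
  - (m%:R * b - alpha) / 3
  + s%:R * ln ((s.-1%:R + m%:R * b) / (s.-1%:R + alpha)) / 3
  + (\sum_(i < m) (w i)%:R * ln (((w i).-1%:R + b) / ((w i).-1%:R + a))
     - W%:R * ln ((W.-1%:R + m%:R * b) / (W.-1%:R + m%:R * a))) / 2
  <= (m%:R - 1) * (m%:R * b - m%:R * a) / 2 / (W%:R + m%:R * b - 1)
     - (m%:R * b - alpha) * (alpha - 1) / 3 / (s%:R + alpha - 1).
Proof.
move=> EW m0 alpha1 alphab a1 ab.
have m1 : 1 <= m%:R :> R by rewrite ler1n.
have s0 : 0 <= s%:R :> R by [].
have W0 : 0 <= W%:R :> R by [].
have ma : m%:R < m%:R * a by rewrite -[ltLHS]mulr1 ltr_pM2l// ltr0n.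
have mab : m%:R * a <= m%:R * b by rewrite ler_pM2l// ltr0n.
rewrite !mul_ln_ratio_pred.
under eq_bigr do rewrite mul_ln_ratio_pred.
have HJ := @sum_mul_ln_ratio_le R m (a - 1) (b - 1) (fun i => (w i)%:R).
have {}HJ := HJ ltac:(lra) ltac:(lra) ltac:(by []).
rewrite -natr_sum -EW !mulrBr !mulr1 in HJ.
have HS := mul_ln_ratio_shift_le m1 ma mab W0.
(* Since [s / (s + alpha - 1) = 1 - (alpha - 1) / (s + alpha - 1)], a third of the leading term here
   cancels the constant of the goal. *)
have HD : s%:R * ln ((s%:R + (m%:R * b - 1)) / (s%:R + (alpha - 1))) <=
    (m%:R * b - alpha) - (m%:R * b - alpha) * (alpha - 1) / (s%:R + alpha - 1).
  have h1 : 0 < s%:R + (alpha - 1) by lra.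
  have h2 : 0 < s%:R + (m%:R * b - 1) by lra.
  have := @ln_le_sub1 _ ((s%:R + (m%:R * b - 1)) / (s%:R + (alpha - 1))).
  rewrite divr_gt0// => /(_ isT) /(ler_wpM2l s0) /le_trans; apply.
  rewrite le_eqVlt; apply/orP; left; apply/eqP.
  have -> : s%:R + alpha - 1 = s%:R + (alpha - 1) by rewrite addrA.
  by field; rewrite gt_eqF.
set x := _ / (W%:R + m%:R * b - 1) in HS.
set y := _ / (s%:R + alpha - 1) in HD.
rewrite [leRHS](_ : _ = x / 2 - y / 3); last by rewrite /x /y; ring.
lra.
Qed.

(** * Expected loss difference *)

Section integrable_closure.
Context (R : realType) (d : measure_display) (T : measurableType d).
Context (P : probability T R).
Implicit Types f g : T -> R.

Let integ f := P.-integrable setT (EFin \o f).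

Lemma integrable_realD f g : integ f -> integ g -> integ (fun t => f t + g t).
Proof.
by move=> hf hg; apply: eq_integrable (integrableD measurableT hf hg).
Qed.

Lemma integrable_realZ (c : R) f : integ f -> integ (fun t => c * f t).
Proof.
by move=> hf; apply: eq_integrable (integrableZl measurableT c hf).
Qed.

Lemma integrable_realB f g : integ f -> integ g -> integ (fun t => f t - g t).
Proof.
by move=> hf hg; apply: eq_integrable (integrableB measurableT hf hg).
Qed.

Lemma integrable_real_cst (c : R) : integ (fun=> c).
Proof. exact: finite_measure_integrable_cst. Qed.

Lemma integrable_real_sum (I : Type) (s : seq I) (F : I -> T -> R) :
  (forall i, integ (F i)) -> integ (fun t => \sum_(i <- s) F i t).
Proof.
move=> hF; elim: s => [|i s IH].
  under eq_fun do rewrite big_nil; exact: integrable_real_cst.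
under eq_fun do rewrite big_cons; exact: integrable_realD.
Qed.

Lemma Rintegral_real_sum (I : Type) (s : seq I) (F : I -> T -> R) :
  (forall i, integ (F i)) ->
  \int[P]_t (\sum_(i <- s) F i t) = \sum_(i <- s) \int[P]_t F i t.
Proof.
move=> hF; elim: s => [|i s IH].
  rewrite big_nil; under eq_Rintegral do rewrite big_nil.
  by rewrite Rintegral_cst// mul0r.
rewrite big_cons; under eq_Rintegral do rewrite big_cons.
by rewrite RintegralD ?IH//; [exact: hF|exact: (integrable_real_sum s hF)].
Qed.

Lemma Rintegral_prob_cst (c : R) : \int[P]_t c = c.
Proof.
transitivity (c * fine (P setT)); first exact: Rintegral_cst.
by rewrite probability_setT mulr1.
Qed.

(** The shape shared by the loss difference before and after Stein's identity, so that one pair of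
    linearity lemmas serves both. *)
Lemma integrable_combination (I : finType) (c x y : R) (z : I -> R)
    (F G : T -> R) (H : I -> T -> R) :
  integ F -> integ G -> (forall i, integ (H i)) ->
  integ (fun t => c + x * F t + (\sum_i z i * H i t - y * G t)).
Proof.
move=> iF iG iH; apply: integrable_realD; [apply: integrable_realD|apply: integrable_realB].
- exact: integrable_real_cst.
- exact: integrable_realZ.
- by apply: integrable_real_sum => i; apply: integrable_realZ; apply: iH.
- exact: integrable_realZ.
Qed.

Lemma Rintegral_combination (I : finType) (c x y : R) (z : I -> R)
    (F G : T -> R) (H : I -> T -> R) :
  integ F -> integ G -> (forall i, integ (H i)) ->
  \int[P]_t (c + x * F t + (\sum_i z i * H i t - y * G t)) =
  c + x * \int[P]_t F t
  + (\sum_i z i * \int[P]_t H i t - y * \int[P]_t G t).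
Proof.
move=> iF iG iH.
have ixF := integrable_realZ x iF.
have iyG := integrable_realZ y iG.
have izH i := integrable_realZ (z i) (iH i).
have iH' := integrable_real_sum (index_enum I) izH.
have ic := integrable_real_cst c.
rewrite (RintegralD measurableT (integrable_realD ic ixF) (integrable_realB iH' iyG)).
rewrite (RintegralD measurableT ic ixF) (RintegralB measurableT iH' iyG).
rewrite Rintegral_prob_cst Rintegral_real_sum//.
rewrite (RintegralZl _ measurableT iF) (RintegralZl _ measurableT iG).
congr (_ + (_ - _)); apply: eq_bigr => i _.
exact: (RintegralZl _ measurableT (iH i)).
Qed.

End integrable_closure.

(** Boundedness in [k] makes the Stein lemmas applicable to these logarithms; the bound is the ratio
    minus 1 at [k = 0]. *)
Lemma ln_ratio_bounded (R : realType) (p q : R) (k : nat) :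
  0 < p -> p <= q ->
  0 <= ln ((k%:R + q) / (k%:R + p)) <= (q - p) / p.
Proof.
move=> p0 pq; have k0 : 0 <= k%:R :> R by [].
have kp : 0 < k%:R + p by lra.
have kq : 0 < k%:R + q by lra.
apply/andP; split.
  by rewrite ln_ge0// ler_pdivlMr// mul1r lerD2l.
apply: le_trans (ln_le_sub1 (divr_gt0 kq kp)) _.
rewrite -subr_ge0 [leRHS](_ : _ = (q - p) * k%:R / (p * (k%:R + p))).
  apply: divr_ge0; last by rewrite ltW// mulr_gt0.
  by rewrite mulr_ge0// subr_ge0.
by field; rewrite !gt_eqF.
Qed.

Lemma inv_add_bounded (R : realType) (c : R) (k : nat) :
  0 < c -> 0 < (k%:R + c)^-1 <= c^-1.
Proof.
move=> c0; have k0 : 0 <= k%:R :> R by [].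
have kc : 0 < k%:R + c by lra.
by rewrite invr_gt0 kc lef_pV2 ?posrE// lerDr.
Qed.

Section expected_loss_difference.
Context (R : realType) (d : measure_display) (T : measurableType d).
Context (P : probability T R) (m : nat).
Context (w : 'I_m -> T -> nat) (S : T -> nat) (l : 'I_m -> R).
Let W t := (\sum_(i < m) w i t)%N.
Let L := \sum_(i < m) l i.
Hypothesis law_w : forall i, poisson_law P (w i) (2 * l i).
Hypothesis law_W : poisson_law P W (2 * L).
Hypothesis law_S : poisson_law P S (3 * L).
Hypothesis W_le_S : forall t, (W t <= S t)%N.

(* [mu E 1/(V + c) = E V/(V - 1 + c)] for [V ~ Po(mu)], and [v/(v - 1 + c)] is
   nondecreasing in [v] when [c >= 1]. *)
Lemma Rintegral_inv_le (c : R) : 1 <= c ->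
  2 * L * \int[P]_t ((W t)%:R + c)^-1 <= 3 * L * \int[P]_t ((S t)%:R + c)^-1.
Proof.
move=> c1; have c0 : 0 < c by lra.
have bd k : 0 <= (k%:R + c)^-1 <= c^-1.
  by have /andP[/ltW -> ->] := inv_add_bounded k c0.
rewrite -(Rintegral_poisson_stein law_W bd) -(Rintegral_poisson_stein law_S bd).
apply: le_Rintegral => //.
- exact: (integrable_poisson_stein law_W bd).
- exact: (integrable_poisson_stein law_S bd).
(* At [W t = 0] the left side vanishes; otherwise neither predecessor is a default value. *)
move=> t _; have := W_le_S t; move: (W t) (S t) => [|i] [|j] //= ij.
  by rewrite mul0r mulr_ge0// invr_ge0 addr_ge0// ltW.
have i0 : 0 <= i%:R :> R by [].
have j0 : 0 <= j%:R :> R by [].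
have ij' : i%:R <= j%:R :> R by rewrite ler_nat.
rewrite ler_pdivrMr ?ltr_wpDl// mulrAC ler_pdivlMr ?ltr_wpDl//.
rewrite -!natr1; nra.
Qed.

Variables (alpha a b : R).
Hypotheses (m_gt0 : (0 < m)%N) (alpha_gt1 : 1 < alpha)
  (alpha_lt : alpha < m%:R * b) (a_gt1 : 1 < a) (a_lt : a < b)
  (b_gt1 : 1 < b) (L_gt0 : 0 < L)
  (cond1 : 3 / 2 * (m%:R - 1) * (m%:R * b - m%:R * a)
           <= 2 / 3 * (m%:R * b - alpha) * (alpha - 1)).

Let lnr (p q : R) (k : nat) := ln ((k%:R + q) / (k%:R + p)).

(** Loss at [(alpha, a)] minus loss at the Jeffreys choice, with [b] half the common row size and
    [m%:R * b] in the role of n./2. *)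
Definition loss_difference (t : T) : R :=
  - (m%:R * b - alpha) / 3 + L * lnr alpha (m%:R * b) (S t)
  + (\sum_i l i * lnr a b (w i t)
     - L * lnr (m%:R * a) (m%:R * b) (W t)).

Let m0 : 0 < m%:R :> R. Proof. by rewrite ltr0n. Qed.

Let bdS k : 0 <= lnr alpha (m%:R * b) k <= (m%:R * b - alpha) / alpha.
Proof.
by apply: ln_ratio_bounded; [exact: (lt_trans ltr01 alpha_gt1)|exact: ltW].
Qed.

Let bdw k : 0 <= lnr a b k <= (b - a) / a.
Proof.
by apply: ln_ratio_bounded; [exact: (lt_trans ltr01 a_gt1)|exact: ltW].
Qed.

Let bdW k : 0 <= lnr (m%:R * a) (m%:R * b) k
  <= (m%:R * b - m%:R * a) / (m%:R * a).
Proof.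
apply: ln_ratio_bounded; first by rewrite mulr_gt0// (lt_trans ltr01).
by rewrite ler_pM2l// ltW.
Qed.

Lemma integrable_loss_difference :
  P.-integrable setT (EFin \o loss_difference).
Proof.
apply: integrable_combination.
- exact: (integrable_poisson_bounded law_S bdS).
- exact: (integrable_poisson_bounded law_W bdW).
- by move=> i; exact: (integrable_poisson_bounded (law_w i) bdw).
Qed.

Lemma Rintegral_loss_difference_lt0 : \int[P]_t loss_difference t < 0.
Proof.
have [alpha1' alphab b1] := And3 alpha_gt1 alpha_lt b_gt1.
have [L0 cond] := conj L_gt0 cond1.
have iS := integrable_poisson_bounded law_S bdS.
have iW := integrable_poisson_bounded law_W bdW.
have iw i := integrable_poisson_bounded (law_w i) bdw.
have jS := integrable_poisson_stein law_S bdS.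
have jW := integrable_poisson_stein law_W bdW.
have jw i := integrable_poisson_stein (law_w i) bdw.
pose u := (m%:R * b - alpha) * (alpha - 1) / 3.
pose K := (m%:R - 1) * (m%:R * b - m%:R * a) / 2.
pose g (c : R) (k : nat) : R := (k%:R + c)^-1.
have ma : m%:R < m%:R * a by rewrite -[ltLHS]mulr1 ltr_pM2l.
have mab : m%:R * a < m%:R * b by rewrite ltr_pM2l.
have m1 : 1 <= m%:R :> R by rewrite ler1n.
have bdg (c : R) (c0 : 0 < c) k : 0 <= g c k <= c^-1.
  by have /andP[/ltW g0 g1] := inv_add_bounded k c0; rewrite /g g0.
have alpha1 : 0 < alpha - 1 by lra.
have mb1 : 0 < m%:R * b - 1 by lra.
have u0 : 0 < u by apply: divr_gt0 => //; apply: mulr_gt0 => //; lra.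
have igW := integrable_poisson_bounded law_W (bdg _ mb1).
have igS := integrable_poisson_bounded law_S (bdg _ mb1).
have igS' := integrable_poisson_bounded law_S (bdg _ alpha1).
(* Writing [L] as [3 * L / 3] or [2 * L / 2], and [l i] as [2 * l i / 2], matches the Poisson means
   and eliminates the parameters. *)
have steinE : \int[P]_t loss_difference t =
  \int[P]_t (- (m%:R * b - alpha) / 3
    + 3^-1 * ((S t)%:R * lnr alpha (m%:R * b) (S t).-1)
    + (\sum_i 2^-1 * ((w i t)%:R * lnr a b (w i t).-1)
       - 2^-1 * ((W t)%:R * lnr (m%:R * a) (m%:R * b) (W t).-1))).
  rewrite (Rintegral_combination _ _ _ _ iS iW iw).
  rewrite (Rintegral_combination _ _ _ (fun=> 2^-1) jS jW jw).
  rewrite (Rintegral_poisson_stein law_S bdS) (Rintegral_poisson_stein law_W bdW).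
  congr (_ + _ + (_ - _)); [by field| |by field].
  apply: eq_bigr => i _; rewrite (Rintegral_poisson_stein (law_w i) bdw).
  by field.
have le1 : \int[P]_t loss_difference t <=
    \int[P]_t (K * g (m%:R * b - 1) (W t) - u * g (alpha - 1) (S t)).
  rewrite steinE; apply: le_Rintegral => //.
  - exact: integrable_combination.
  - exact: (integrable_realB (integrable_realZ K igW) (integrable_realZ u igS')).
  move=> t _; rewrite -mulr_sumr -mulrBr [3^-1 * _]mulrC [2^-1 * _]mulrC.
  rewrite /g !addrA.
  by apply: stein_integrand_le => //; exact: ltW.
apply: (le_lt_trans le1).
rewrite (RintegralB measurableT (integrable_realZ K igW) (integrable_realZ u igS')).
rewrite (RintegralZl _ measurableT igW) (RintegralZl _ measurableT igS').
have le2 : K * \int[P]_t g (m%:R * b - 1) (W t) <= u * \int[P]_t g (m%:R * b - 1) (S t).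
  have g0 : 0 <= \int[P]_t g (m%:R * b - 1) (S t).
    by apply: Rintegral_ge0 => t _; case/andP: (bdg _ mb1 (S t)).
  (* The comparison of inverse moments needs a shift of at least 1; this can fail for [m = 1], but
     then [K = 0]. *)
  have [m_eq1|m_neq1] := eqVneq m 1%N.
    have -> : K = 0 by rewrite /K m_eq1 subrr !mul0r.
    by rewrite mul0r; exact: (mulr_ge0 (ltW u0) g0).
  have m2 : 2 <= m%:R :> R by rewrite ler_nat; case: m m_gt0 m_neq1 => [|[]].
  have c1 : 1 <= m%:R * b - 1.
    have : m%:R * 1 <= m%:R * b by rewrite ler_pM2l// ltW.
    by rewrite mulr1; lra.
  have := Rintegral_inv_le c1.
  set x := Rintegral _ _ (fun t => g _ (W t)).
  move: g0; set y := Rintegral _ _ (fun t => g _ (S t)) => y0 xy.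
  have {}xy : x <= 3 / 2 * y.
    rewrite -(ler_pM2l L0); lra.
  have K0 : 0 <= K by apply: divr_ge0 => //; apply: mulr_ge0; lra.
  apply: le_trans (ler_wpM2l K0 xy) _.
  (* [cond1] is twice the inequality [3 / 2 * K <= u]. *)
  rewrite mulrA ler_wpM2r// /K /u; lra.
apply: (le_lt_trans (lerB le2 (lexx _))).
(* Both terms now involve [S] only; strictness comes from [alpha < m%:R * b], at every value of
   [S]. *)
rewrite -mulrBr pmulr_rlt0// -oppr_gt0 opprB -(RintegralB measurableT igS' igS).
pose h (k : nat) := g (alpha - 1) k - g (m%:R * b - 1) k.
apply: (@Rintegral_poisson_gt0 _ _ _ P S (3 * L) law_S h (alpha - 1)^-1) => k.
have k0 : 0 <= k%:R :> R by [].
rewrite /h /g subr_gt0 ltf_pV2 ?posrE; [|lra..].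
apply/andP; split; first by lra.
have /andP[_ hk] := inv_add_bounded k alpha1.
have /andP[hk' _] := inv_add_bounded k mb1.
by lra.
Qed.

End expected_loss_difference.

(** * The sampling model and the estimators *)

Lemma poisson_prob_set1 (R : realType) (mu : R) (x : nat) : 0 <= mu ->
  poisson_prob mu 0 [set x] = (poisson_weight mu x)%:E.
Proof.
rewrite /poisson_prob le_eqVlt => /predU1P[<-|mu0].
  rewrite ltxx diracE /poisson_weight oppr0 expR0 mulr1 expr0n.
  case: x => [|x]; first by rewrite mem_set// fact0 invr1 mulr1.
  by rewrite memNset// mul0r.
by rewrite mu0 esum_set1 ?lee_fin ?poisson_pmf_ge0// /poisson_pmf mu0.
Qed.

Definition obs_mean (R : realType) (m : nat) (n : 'I_m -> nat)
    (lam : array R n) (k : obs_index n) : R :=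
  match k with
  | inl (inl ij) => lam (tag ij) (tagged ij)
  | inl (inr i) => \sum_(j < n i) lam i j
  | inr _ => \sum_(i < m) \sum_(j < n i) lam i j
  end.

(** An arbitrary commutative law covers both the [nat] sums of observations and the real sums of
    means. *)
Lemma big_obs_index (m : nat) (n : 'I_m -> nat) (U : Type) (idx : U)
    (op : Monoid.com_law idx)
    (p : pred (obs_index n)) (F : obs_index n -> U) :
  \big[op/idx]_(k | p k) F k =
  op (op (\big[op/idx]_(i < m)
            \big[op/idx]_(j < n i | p (inl (inl (Tagged (fun i => 'I_(n i)) j))))
              F (inl (inl (Tagged (fun i => 'I_(n i)) j))))
         (\big[op/idx]_(i < m | p (inl (inr i))) F (inl (inr i))))
     (if p (inr tt) then F (inr tt) else idx).
Proof.
rewrite big_sumType big_sumType /=; congr (op (op _ _) _).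
  rewrite (@sig_big_dep _ _ _ _ _ predT
    (fun i j => p (inl (inl (Tagged (fun i => 'I_(n i)) j))))
    (fun i j => F (inl (inl (Tagged (fun i => 'I_(n i)) j)))))/=.
  by apply: eq_big => -[i j].
case: ifP => ptt; first by rewrite (big_pred1 tt)// => -[]; rewrite ptt.
by rewrite big_pred0// => -[].
Qed.

(** Common source of the laws of S, W_i and W, which differ only in the predicate [p]. *)
Lemma poisson_law_obs_sum (R : realType) (d : measure_display)
    (T : measurableType d) (m : nat) (n : 'I_m -> nat) (Q : probability T R)
    (X : array {mfun T >-> nat} n) (Y : 'I_m -> {mfun T >-> nat})
    (Z : {mfun T >-> nat}) (lam : array R n) (p : pred (obs_index n)) :
  positive_array lam -> poisson_sampling Q X Y Z lam ->
  poisson_law Q (fun t => (\sum_(k | p k) observations X Y Z k t)%N)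
    (\sum_(k | p k) obs_mean lam k).
Proof.
move=> lam0 [lawX lawY lawZ indep].
have mean0 k : 0 <= obs_mean lam k.
  case: k => [[ij|i]|[]] /=; first exact: ltW.
    by apply: sumr_ge0 => j _; exact: ltW.
  by apply: sumr_ge0 => i _; apply: sumr_ge0 => j _; exact: ltW.
have law1 k x : Q (observations X Y Z k @^-1` [set x]) =
    (poisson_weight (obs_mean lam k) x)%:E.
  rewrite -poisson_prob_set1//.
  case: k => [[[i j]|i]|[]] /=; [exact: lawX|exact: lawY|exact: lawZ].
split.
- have := @measurable_comp_ffun _ _ _ _ _ (observations X Y Z)
    (fun v : {ffun obs_index n -> nat} => (\sum_(k | p k) v k)%N).
  rewrite (_ : (fun t => _) = (fun t => (\sum_(k | p k) observations X Y Z k t)%N))//.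
  by apply/funext => t; apply: eq_bigr => k _; rewrite ffunE.
- by apply: sumr_ge0.
move=> x.
(* With [J] empty, only the law of the sum is left. *)
have := @independent_poisson_sum _ _ _ Q _ (observations X Y Z) (obs_mean lam) indep law1
  (enum p) finset.set0 (fun=> setT) x (enum_uniq p).
rewrite big_set0 mule1 big_enum/= => <-; last by move=> k _; rewrite inE.
congr (Q _); apply/seteqP; split => t /=.
  move=> <-; split => /=; first by rewrite big_enum.
  by move=> k; rewrite /= inE.
by move=> [<- _]; rewrite big_enum.
Qed.

Section sampling_totals.
Context (R : realType) (d : measure_display) (T : measurableType d).
Context (m : nat) (n : 'I_m -> nat) (Q : probability T R).
Context (X : array {mfun T >-> nat} n) (Y : 'I_m -> {mfun T >-> nat}).
Context (Z : {mfun T >-> nat}) (lam : array R n).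
Hypotheses (lam_gt0 : positive_array lam)
  (model : poisson_sampling Q X Y Z lam).

Let x t : array nat n := fun i j => @X i j t.

Lemma poisson_law_total :
  poisson_law Q
    (fun t => (grand_total (x t) + \sum_(k < m) Y k t + Z t)%N)
    (3 * \sum_(i < m) \sum_(j < n i) @lam i j).
Proof.
have := poisson_law_obs_sum predT lam_gt0 model.
rewrite (big_obs_index (@GRing.add R)) /=.
under eq_fun do rewrite big_obs_index /=.
by congr poisson_law; ring.
Qed.

Lemma poisson_law_row (i : 'I_m) :
  poisson_law Q (fun t => (row_total (x t) i + Y i t)%N)
    (2 * \sum_(j < n i) @lam i j).
Proof.
(* The entries of row [i] and [Y i]; each group contributes the row mean once. *)
pose p (k : obs_index n) := match k with
  | inl (inl ij) => tag ij == i | inl (inr i') => i' == i | inr _ => false end.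
have := poisson_law_obs_sum p lam_gt0 model.
have row U (idx : U) (op : Monoid.com_law idx) (F : forall i, 'I_(n i) -> U) :
    \big[op/idx]_(i' < m) \big[op/idx]_(j < n i' | i' == i) F i' j
    = \big[op/idx]_(j < n i) F i j.
  rewrite (bigD1 i)//= [X in op _ X]big1 ?Monoid.mulm1.
    by apply: eq_bigl => j; rewrite eqxx.
  by move=> k /negbTE ki; rewrite big_pred0// => j; rewrite ki.
rewrite (big_obs_index (@GRing.add R)) /= row big_pred1_eq addr0.
under eq_fun do rewrite big_obs_index /= row big_pred1_eq addn0.
by congr poisson_law; ring.
Qed.

Lemma poisson_law_rows :
  poisson_law Q (fun t => (\sum_(i < m) (row_total (x t) i + Y i t))%N)
    (2 * \sum_(i < m) \sum_(j < n i) @lam i j).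
Proof.
have := poisson_law_obs_sum
  (fun k => if k is inl _ then true else false) lam_gt0 model.
rewrite (big_obs_index (@GRing.add R)) /= addr0.
under eq_fun do rewrite big_obs_index /= addn0 -big_split /=.
by congr poisson_law; ring.
Qed.

End sampling_totals.

Lemma lambda_hat_JeffreysE (R : realType) (m : nat) (n : 'I_m -> nat)
    (x : array nat n) (y : 'I_m -> nat) (z : nat) :
  @lambda_hat_Jeffreys R m n x y z =
  lambda_hat ((\sum_(k < m) n k)%N%:R / 2) (fun k => (n k)%:R / 2) x y z.
Proof.
rewrite /lambda_hat_Jeffreys /lambda_hat.
by rewrite -mulr_suml -natr_sum.
Qed.

(** * Losses and bounds for the family of estimators *)

Section lambda_hat_theory.
Context (R : realType) (m : nat) (n : 'I_m -> nat).
Hypotheses (m_gt0 : (0 < m)%N) (n_gt0 : forall i, (0 < n i)%N).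
Implicit Types (x : array nat n) (y : 'I_m -> nat) (z : nat) (alpha : R)
  (a : 'I_m -> R).

Let rows x y i := (row_total x i + y i)%N.

Let rowsE x y : (grand_total x + \sum_(k < m) y k)%N = (\sum_(i < m) rows x y i)%N.
Proof. by rewrite /rows big_split. Qed.

Lemma sumr_params_gt0 a : (forall i, 0 < a i) -> 0 < \sum_(i < m) a i.
Proof.
move=> a0; rewrite (bigD1 (Ordinal m_gt0))//= ltr_wpDr//.
by apply: sumr_ge0 => i _; exact: ltW.
Qed.

Lemma lambda_hat_gt0 alpha a x y z i j : 0 < alpha -> (forall i, 0 < a i) ->
  0 < @lambda_hat R m n alpha a x y z i j.
Proof.
move=> alpha0 a0; have A0 := sumr_params_gt0 a0.
have n0 : 0 < (n i)%:R / 2 :> R by rewrite divr_gt0// ltr0n.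
by rewrite /lambda_hat !mulr_gt0 ?invr_gt0// ltr_wpDl// divr_gt0.
Qed.

(** The within-row factors sum to one over [j], and then the row factors sum to one over [i]. *)
Lemma sum_lambda_hat alpha a x y z : (forall i, 0 < a i) ->
  \sum_(i < m) \sum_(j < n i) @lambda_hat R m n alpha a x y z i j =
  ((grand_total x + \sum_(k < m) y k + z)%N%:R + alpha) / 3.
Proof.
move=> a0; have A0 := sumr_params_gt0 a0.
have inner i :
      \sum_(j < n i) ((x i j)%:R + 1 / 2) / ((row_total x i)%:R + (n i)%:R / 2) = 1 :> R.
  rewrite -mulr_suml big_split/= sumr_const card_ord -natr_sum -/(row_total x i).
  rewrite -[_ *+ n i]mulr_natl mulrA mulr1 divff// gt_eqF// ltr_wpDl//.
  by rewrite divr_gt0// ltr0n.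
rewrite /lambda_hat.
under eq_bigr do rewrite -mulr_sumr inner mulr1.
rewrite -mulr_sumr -mulr_suml big_split/= -natr_sum rowsE.
by rewrite divff ?mulr1// gt_eqF// ltr_wpDl.
Qed.

Lemma entropy_loss_lambda_hatB alpha beta a b x y z (lam : array R n) :
  positive_array lam -> 0 < alpha -> 0 < beta ->
  (forall i, 0 < a i) -> (forall i, 0 < b i) ->
  let l i := \sum_(j < n i) lam i j in
  let W := (\sum_(i < m) rows x y i)%N in
  entropy_loss (lambda_hat alpha a x y z) lam
    - entropy_loss (lambda_hat beta b x y z) lam =
  - (beta - alpha) / 3
  + (\sum_(i < m) l i) * ln (((W + z)%N%:R + beta) / ((W + z)%N%:R + alpha))
  + (\sum_(i < m) l i * ln (((rows x y i)%:R + b i) / ((rows x y i)%:R + a i))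
     - (\sum_(i < m) l i)
       * ln ((W%:R + \sum_(i < m) b i) / (W%:R + \sum_(i < m) a i))).
Proof.
move=> lam0 alpha0 beta0 a0 b0 l W.
have A0 := sumr_params_gt0 a0; have B0 := sumr_params_gt0 b0.
(* Logarithm of the [(beta, b)] estimate over the [(alpha, a)] estimate; the common within-row
   factor cancels, so [j] does not appear. *)
pose r i := ln (((W + z)%N%:R + beta) / ((W + z)%N%:R + alpha))
  + ln (((rows x y i)%:R + b i) / ((rows x y i)%:R + a i))
  - ln ((W%:R + \sum_(i < m) b i) / (W%:R + \sum_(i < m) a i)).
have pos (N : nat) (c : R) : 0 < c -> 0 < N%:R + c by move=> c0; rewrite ltr_wpDl.
have step i j :
    (@lambda_hat R m n alpha a x y z i j - lam i j
      - lam i j * ln (@lambda_hat R m n alpha a x y z i j / lam i j))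
    - (@lambda_hat R m n beta b x y z i j - lam i j
      - lam i j * ln (@lambda_hat R m n beta b x y z i j / lam i j))
    = @lambda_hat R m n alpha a x y z i j - @lambda_hat R m n beta b x y z i j
      + lam i j * r i.
  have n0 : 0 < (n i)%:R / 2 :> R by rewrite divr_gt0// ltr0n.
  rewrite !ln_div ?posrE ?lambda_hat_gt0//.
  suff -> : r i = ln (@lambda_hat R m n beta b x y z i j)
      - ln (@lambda_hat R m n alpha a x y z i j).
    by ring.
  rewrite /r /lambda_hat rowsE -/W -/(rows x y i).
  have half0 : 0 < 1 / 2 :> R by rewrite divr_gt0.
  have lnE (u v v' c : R) : 0 < u -> 0 < v -> 0 < v' -> 0 < c ->
      ln (u / 3 * (v / v') * c) = ln u - ln 3 + (ln v - ln v') + ln c.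
    move=> u0 v0 v0' c0.
    have u30 : 0 < u / 3 by rewrite divr_gt0.
    have vv0 : 0 < v / v' by rewrite divr_gt0.
    have uv0 : 0 < u / 3 * (v / v') by rewrite mulr_gt0.
    by rewrite lnM ?posrE// lnM ?posrE// !ln_div ?posrE.
  have c0 : 0 < ((x i j)%:R + 1 / 2) / ((row_total x i)%:R + (n i)%:R / 2) :> R.
    by rewrite divr_gt0// pos.
  by rewrite !lnE ?pos// !ln_div ?posrE ?pos//; ring.
rewrite /entropy_loss -sumrB.
under eq_bigr => i _.
  rewrite -sumrB; under eq_bigr do rewrite step.
  rewrite big_split/= sumrB -mulr_suml; over.
rewrite big_split/= sumrB !sum_lambda_hat// rowsE -/W.
rewrite /r -/l.
under [X in _ + X = _]eq_bigr do rewrite mulrBr mulrDr.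
rewrite sumrB big_split/= -!mulr_suml.
by field.
Qed.

(** After regrouping, two quotients have numerator at least their denominator, and
    [((x i j)%:R + 1 / 2) / 3] is at least 1/6. *)
Lemma lambda_hat_ge alpha a x y z i j :
  \sum_(i < m) a i <= alpha -> (forall i, (n i)%:R / 2 <= a i) ->
  6^-1 <= @lambda_hat R m n alpha a x y z i j.
Proof.
move=> Aalpha na.
have pos (N : nat) (c : R) : 0 < c -> 0 < N%:R + c by move=> c0; rewrite ltr_wpDl.
have n0 k : 0 < (n k)%:R / 2 :> R by rewrite divr_gt0// ltr0n.
have A0 := sumr_params_gt0 (fun k => lt_le_trans (n0 k) (na k)).
rewrite /lambda_hat.
set W := (grand_total x + _)%N.
have D1 := pos W _ A0.
have D2 := pos (row_total x i) _ (n0 i).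
have q1 : 1 <= ((W + z)%N%:R + alpha) / (W%:R + \sum_(k < m) a k).
  by rewrite ler_pdivlMr// mul1r lerD// ler_nat leq_addr.
have q2 : 1 <= ((row_total x i + y i)%N%:R + a i) / ((row_total x i)%:R + (n i)%:R / 2).
  by rewrite ler_pdivlMr// mul1r lerD// ler_nat leq_addr.
have q3 : 6^-1 <= ((x i j)%:R + 1 / 2) / 3 :> R.
  have : 0 <= (x i j)%:R :> R by [].
  lra.
have : 1 <= (((W + z)%N%:R + alpha) / (W%:R + \sum_(k < m) a k))
    * (((row_total x i + y i)%N%:R + a i) / ((row_total x i)%:R + (n i)%:R / 2)).
  exact: mulr_ege1.
move=> q12; rewrite [leRHS](_ : _ = ((((W + z)%N%:R + alpha) / (W%:R + \sum_(k < m) a k))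
    * (((row_total x i + y i)%N%:R + a i) / ((row_total x i)%:R + (n i)%:R / 2)))
    * (((x i j)%:R + 1 / 2) / 3)); last by ring.
by apply: (le_trans q3); rewrite ler_peMl// (le_trans _ q3).
Qed.

(** A positive component is at most the sum of all components. *)
Lemma lambda_hat_le alpha a x y z i j : 0 < alpha -> (forall i, 0 < a i) ->
  @lambda_hat R m n alpha a x y z i j <=
  ((grand_total x + \sum_(k < m) y k + z)%N%:R + alpha) / 3.
Proof.
move=> alpha0 a0; rewrite -(@sum_lambda_hat alpha a)//.
rewrite (bigD1 i)//= (bigD1 j)//= -addrA lerDl addr_ge0//.
  by apply: sumr_ge0 => k _; rewrite ltW// lambda_hat_gt0.
by apply: sumr_ge0 => i' _; apply: sumr_ge0 => k _; rewrite ltW// lambda_hat_gt0.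
Qed.

End lambda_hat_theory.

(** * Integrability of the Jeffreys loss *)

Lemma normr_ln_le (R : realType) (y : R) : 0 < y -> `|ln y| <= y + y^-1.
Proof.
move=> y0; have y1 : 0 < y^-1 by rewrite invr_gt0.
have := ln_sublinear y0; have := ln_sublinear y1.
by rewrite lnV ?posrE// ler_norml => h1 h2; apply/andP; split; lra.
Qed.

(** The lower bound 1/6 turns [l * (l / e)] into a constant, while [e] and [l * (e / l)] each cost
    one [M]. *)
Lemma entropy_loss_term_bound (R : realType) (e l M : R) :
  6^-1 <= e -> e <= M -> 0 < l ->
  `|e - l - l * ln (e / l)| <= 2 * M + (l + 6 * l ^+ 2).
Proof.
move=> e6 eM l0; have e0 : 0 < e by lra.
have := normr_ln_le (divr_gt0 e0 l0); rewrite invf_div.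
move=> /(ler_wpM2l (ltW l0)).
rewrite mulrDr [l * (e / l)]mulrC divfK ?gt_eqF// => h.
have h2 : l * (l / e) <= 6 * l ^+ 2.
  rewrite mulrA -expr2 ler_pdivrMr// mulrAC ler_peMl ?sqr_ge0//; lra.
apply: (le_trans (ler_normB _ _)).
rewrite normrM (gtr0_norm l0).
apply: le_trans (lerD (ler_normB _ _) h) _.
rewrite (gtr0_norm l0) (gtr0_norm e0); lra.
Qed.

(** The loss is dominated by an affine function of S. Finiteness of this risk allows the other risk
    to be split and the common part cancelled. *)
Lemma integrable_entropy_loss_Jeffreys (R : realType) (d : measure_display)
    (T : measurableType d) (m : nat) (n : 'I_m -> nat) (Q : probability T R)
    (X : array {mfun T >-> nat} n) (Y : 'I_m -> {mfun T >-> nat})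
    (Z : {mfun T >-> nat}) (lam : array R n) :
  (0 < m)%N -> (forall i, (0 < n i)%N) ->
  positive_array lam -> poisson_sampling Q X Y Z lam ->
  Q.-integrable setT (EFin \o (fun t => entropy_loss
    (@lambda_hat_Jeffreys R m n (fun i j => X i j t) (fun i => Y i t) (Z t)) lam)).
Proof.
move=> m0 n0 lam0 model.
pose x t : array nat n := fun i j => X i j t.
pose S t := (grand_total (x t) + \sum_(k < m) Y k t + Z t)%N.
pose beta : R := (\sum_(k < m) n k)%N%:R / 2.
(* Constant part of the termwise bound with [M = (S + beta) / 3], after [2 * M <= S + beta]. *)
pose C (i : 'I_m) (j : 'I_(n i)) : R :=
  beta + (lam i j + 6 * lam i j ^+ 2).
have iS : Q.-integrable setT (EFin \o (fun t => (S t)%:R : R)).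
  (* Stein's identity for the constant function 1 gives integrability of [S]. *)
  have := @integrable_poisson_stein _ _ _ _ _ _ (poisson_law_total lam0 model)
    (fun=> 1) 1 (fun=> ltac:(by rewrite ler01 lexx)).
  by under eq_fun do rewrite mulr1.
have b0 (k : 'I_m) : 0 < (n k)%:R / 2 :> R by rewrite divr_gt0// ltr0n.
have beta0 : 0 < beta by rewrite /beta natr_sum mulr_suml; exact: sumr_params_gt0.
apply: (@le_integrable _ _ _ _ _ measurableT _
  (EFin \o (fun t => \sum_(i < m) \sum_(j < n i) ((S t)%:R + C i j)))).
- apply/measurable_realfun.measurable_EFinP.
  have := @measurable_comp_ffun _ _ _ _ _ (observations X Y Z)
    (fun v : {ffun obs_index n -> nat} => entropy_loss
      (@lambda_hat_Jeffreys R m n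
        (fun i j => v (inl (inl (Tagged (fun i => 'I_(n i)) j))))
        (fun i => v (inl (inr i))) (v (inr tt))) lam).
  congr measurable_fun; apply/funext => t; congr (entropy_loss _ _).
  by rewrite ffunE; congr lambda_hat_Jeffreys;
    [apply: functional_extensionality_dep => i|]; apply/funext => j; rewrite ffunE.
- move=> t _; rewrite /= lee_fin.
  apply: le_trans (ler_norm _).
  apply: le_trans (ler_norm_sum _ _ _) _; apply: ler_sum => i _.
  apply: le_trans (ler_norm_sum _ _ _) _; apply: ler_sum => j _.
  rewrite lambda_hat_JeffreysE.
  apply: le_trans (@entropy_loss_term_bound _ _ _ (((S t)%:R + beta) / 3) _ _ (lam0 i j)) _.
  + apply: lambda_hat_ge => //.
    by rewrite natr_sum mulr_suml.
  + exact: lambda_hat_le.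
  rewrite /C; have : 0 <= (S t)%:R :> R by [].
  lra.
- apply: integrable_real_sum => i; apply: integrable_real_sum => j.
  exact: (integrable_realD iS (integrable_real_cst _ _)).
Qed.

Theorem theorem3p3 (R : realType) (m : nat) (n : 'I_m -> nat)
  (d : measure_display) (T : measurableType d)
  (P : array R n -> probability T R)
  (X : array {mfun T >-> nat} n) (Y : 'I_m -> {mfun T >-> nat})
  (Z : {mfun T >-> nat})
  (model : forall lam : array R n, positive_array lam ->
     poisson_sampling (P lam) X Y Z lam)
  (alpha : R) (a : 'I_m -> R)
  (m_gt0 : (0 < m)%N)
  (alpha_gt0 : 0 < alpha) (a_gt0 : forall i : 'I_m, 0 < a i)
  (n_const : forall i k : 'I_m, n i = n k)
  (n_gt2 : forall i : 'I_m, (2 < n i)%N)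
  (alpha_bounds : 1 < alpha < (\sum_(i < m) n i)%N%:R / 2)
  (a_const : forall i k : 'I_m, a i = a k)
  (a_bounds : forall i : 'I_m, (m%:R + 1) / m%:R <= a i < (n i)%:R / 2)
  (cond1 :
     3 / 2 * (m%:R - 1) * ((\sum_(i < m) n i)%N%:R / 2 - \sum_(i < m) a i)
     <= 2 / 3 * ((\sum_(i < m) n i)%N%:R / 2 - alpha) * (alpha - 1))
  (cond2 :
     (m%:R - 1) * ((\sum_(i < m) n i)%N%:R / 2 - \sum_(i < m) a i) / 2
     <= ((\sum_(i < m) n i)%N%:R / 2 - alpha)
        * ((\sum_(i < m) n i)%N%:R / 2 - 1) / 3) :
  risk_dominated_by P X Y Z (@lambda_hat_Jeffreys R m n) (@lambda_hat R m n alpha a).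
Proof.
pose i0 := Ordinal m_gt0.
pose b : R := (n i0)%:R / 2.
pose a0 := a i0.
have m0 : 0 < m%:R :> R by rewrite ltr0n.
have bE k : (n k)%:R / 2 = b by rewrite (n_const k i0).
have aE k : a k = a0 by apply: a_const.
have NE : (\sum_(k < m) n k)%N%:R / 2 = m%:R * b.
  rewrite natr_sum mulr_suml (eq_bigr _ (fun k _ => bE k)).
  by rewrite sumr_const card_ord mulr_natl.
have AE : \sum_(k < m) a k = m%:R * a0.
  by rewrite (eq_bigr _ (fun k _ => aE k)) sumr_const card_ord mulr_natl.
move: alpha_bounds cond1 (a_bounds i0); rewrite NE AE -/b -/a0.
move=> /andP[alpha1 alphab] cond /andP[ma ab].
(* [(m + 1) / m = 1 + 1 / m] exceeds 1, so the Stein shift leaves [a0 - 1] positive. *)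
have a1 : 1 < a0.
  by apply: lt_le_trans ma; rewrite mulrDl divff ?gt_eqF// mul1r ltrDl invr_gt0.
have b1 : 1 < b by exact: lt_trans ab.
have n0 k : (0 < n k)%N by apply: leq_trans (n_gt2 k).
(* Strictness at every positive array yields both halves of domination. *)
have lt_risk lam : positive_array lam ->
    (risk P X Y Z (@lambda_hat R m n alpha a) lam
     < risk P X Y Z (@lambda_hat_Jeffreys R m n) lam)%E.
  move=> lam0; have mod := model _ lam0.
  pose x t : array nat n := fun i j => X i j t.
  pose w (i : 'I_m) t := (row_total (x t) i + Y i t)%N.
  pose S t := (grand_total (x t) + \sum_(k < m) Y k t + Z t)%N.
  pose l (i : 'I_m) := \sum_(j < n i) lam i j.
  have law_w i : poisson_law (P lam) (w i) (2 * l i) := poisson_law_row lam0 mod i.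
  have law_W := poisson_law_rows lam0 mod.
  have law_S := poisson_law_total lam0 mod.
  have W_le_S t : (\sum_(i < m) w i t <= S t)%N.
    by rewrite /S /w big_split/= leq_addr.
  have L0 : 0 < \sum_(i < m) l i.
    by apply: sumr_params_gt0 => // i; apply: sumr_params_gt0.
  have iD := integrable_loss_difference law_w law_W law_S m_gt0 alpha1 alphab a1 ab.
  have D0 := Rintegral_loss_difference_lt0 law_w law_W law_S W_le_S m_gt0 alpha1
    alphab a1 ab b1 L0 cond.
  have iJ := integrable_entropy_loss_Jeffreys m_gt0 n0 lam0 mod.
  have lossE t : entropy_loss (lambda_hat alpha a (x t) (fun i => Y i t) (Z t)) lam
      = entropy_loss (@lambda_hat_Jeffreys R m n (x t) (fun i => Y i t) (Z t)) lam
        + loss_difference w S l alpha a0 b t.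
    rewrite lambda_hat_JeffreysE.
    rewrite -[LHS](subrK (entropy_loss (lambda_hat
      ((\sum_(k < m) n k)%N%:R / 2) (fun k => (n k)%:R / 2)
      (x t) (fun i => Y i t) (Z t)) lam)) addrC; congr (_ + _).
    rewrite entropy_loss_lambda_hatB;
      [|by []..|by rewrite NE; lra|by []|by move=> k; rewrite bE; lra].
    have -> : \sum_(k < m) (n k)%:R / 2 = m%:R * b by rewrite -NE natr_sum mulr_suml.
    rewrite /loss_difference NE AE /S big_split/=.
    congr (_ + _ + (_ - _)); apply: eq_bigr => i _.
    by rewrite bE aE.
  rewrite /risk !unlock.
  under eq_integral do rewrite lossE.
  rewrite integralD_EFin//.
  (* The Jeffreys risk is finite and cancels, leaving the expected loss difference. *)
  rewrite -[ltRHS]adde0 lteD2lE; last exact: integrable_fin_num iJ.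
  rewrite -(fineK (integrable_fin_num measurableT iD)) lte_fin.
  exact: D0.
split; first by move=> lam lam0; exact/ltW/lt_risk.
by exists (fun _ _ => 1) => [i j|]; [exact: ltr01|apply: lt_risk => i j; exact: ltr01].
Qed.
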